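(* Let $\mathcal{E}_{2,2}$ be a mixed ellipsoid with non-increasing semi-axes $\{\mu_n\}_{n\in\mathbb{N}^*}$ tending to zero and dimensions $\{d_n\}_{n\in\mathbb{N}^*}$, let $\varepsilon\in(0,\mu_1)$, and let $\gamma\ge1$ be allowed to depend on $\varepsilon$. Let $k\in\mathbb{N}^*$ be such that $\mu_{k+1}\le\varepsilon<\mu_k$. Then, under the assumption $d_1,\dots,d_k\ge9$, we have $$N\left(\varepsilon_\gamma;\mathcal{E}_{2,2},\|\cdot\|_2\right)^{1/\bar d_k}\,\varepsilon_\gamma\ \le\ \kappa_k\prod_{j=1}^k\mu_j^{d_j/\bar d_k},$$ where $\bar d_k=d_1+\dots+d_k$, $\varepsilon_\gamma=\varepsilon\left(1+\bar d_k^{-\gamma}\sqrt{k+1}\right)$, and $\{\kappa_k\}_{k\in\mathbb{N}^*}$ is a sequence satisfying $$\log(\kappa_k)=O_{k\to\infty}\left(\frac{\gamma\,k\,\log(\bar d_k)}{\bar d_k}\right).$$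
   Context: $\mathbb{N}^*=\{1,2,\dots\}$ and $\log$ is the logarithm to base 2. Given dimensions $\{d_n\}_{n\in\mathbb{N}^*}\subset\mathbb{N}^*$ and positive semi-axes $\{\mu_n\}_{n\in\mathbb{N}^*}$, the mixed ellipsoid is $$\mathcal{E}_{2,2}=\left\{x=(x_1,x_2,\dots)\in\mathbb{R}^{d_1}\times\mathbb{R}^{d_2}\times\cdots\ :\ \left(\sum_{j=1}^\infty\left(\|x_j\|_2/\mu_j\right)^2\right)^{1/2}\le1\right\},$$ where $\|x_j\|_2$ is the Euclidean norm on $\mathbb{R}^{d_j}$. Its elements are identified with square-summable real sequences by concatenating the blocks, and $\|\cdot\|_2$ is the $\ell^2$-norm. The covering number $N(\rho;\mathcal{K},\|\cdot\|_2)$ is the smallest cardinality of a set of points of $\ell^2$ such that each $x\in\mathcal{K}$ is within $\|\cdot\|_2$-distance at most $\rho$ of one of these points. *)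

(* Defs.v *)
From mathcomp Require Export all_boot all_order all_algebra.
From mathcomp Require Export all_classical all_reals all_analysis.

Set Implicit Arguments.
Unset Strict Implicit.
Unset Printing Implicit Defensive.

Export Order.TTheory GRing.Theory Num.Theory.
Export numFieldNormedType.Exports.

Local Open Scope classical_set_scope.
Local Open Scope ring_scope.

(* Indices are shifted by one: for sequences written u_1, u_2, ... on paper,
   u_{j+1} is [u j]. *)

Definition log2 (R : realType) (x : R) : R := ln x / ln 2.

(* The norm provided by the library on row vectors is the sup norm. *)
Definition eucl_norm (R : realType) (n : nat) (v : 'rV[R]_n) : R :=
  Num.sqrt (\sum_(i < n) v ord0 i ^+ 2).

Definition l2norm (R : realType) (x : nat -> R) : \bar R :=
  'N[counting]_(2%:E)[EFin \o x]%E.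

Definition ell2 (R : realType) : set (nat -> R) :=
  [set x | (l2norm x < +oo)%E].

Definition dbar (d : nat -> nat) (k : nat) : nat := (\sum_(j < k) d j)%N.

(* The component in R^(d j) of a sequence regarded as the concatenation of
   blocks of lengths d 0, d 1, ...; when all the d j are positive,
   x |-> (block d x j)_j is a bijection from sequences onto the product of the
   R^(d j). *)
Definition block (R : realType) (d : nat -> nat) (x : nat -> R) (j : nat) :
    'rV[R]_(d j) :=
  \row_(i < d j) x (dbar d j + i)%N.

Definition mixed_ellipsoid (R : realType) (d : nat -> nat) (mu : nat -> R) :
    set (nat -> R) :=
  [set x | (l2norm (fun j => eucl_norm (block d x j) / mu j)%R <= 1)%E].

Definition is_cover (R : realType) (rho : R) (K A : set (nat -> R)) : Prop :=
  A `<=` @ell2 R /\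
  forall x, K x -> exists2 c, A c & (l2norm (x \- c)%R <= rho%:E)%E.

(* Equal to +oo when no finite set covers K. *)
Definition covering_number (R : realType) (rho : R) (K : set (nat -> R)) :
    \bar R :=
  ereal_inf [set n%:R%:E | n in
    [set n : nat | exists A, is_cover rho K A /\ (A #= `I_n)%card]].

Definition eps_gamma (R : realType) (d : nat -> nat) (k : nat)
    (eps gamma : R) : R :=
  eps * (1 + (dbar d k)%:R `^ (- gamma) * Num.sqrt k.+1%:R).

(* Main.v *)
Require Import Defs.
From mathcomp Require Import ring lra zify.
Set Implicit Arguments.
Unset Strict Implicit.
Unset Printing Implicit Defensive.
Local Open Scope classical_set_scope.
Local Open Scope ring_scope.

(* The core is a bound of Rogers type: in dimension n, a ball of radius mu is
   covered by poly(n) (mu / eps)^n balls of radius eps, up to a small relative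
   enlargement of the radius.  The centres are chosen greedily among the points
   of a fine grid in the ball of radius (mu^2 - eps^2)^(1/2): each point x of the
   large ball is within eps of a fraction (eps / mu)^n / poly(n) of them, since
   near (1 - eps^2 / mu^2) x there is a translate of a thin central slab of a
   ball whose radius is eps / mu times that of the ball of centres.  The few
   points of a net that are still uncovered are added as centres.

   For the ellipsoid, cover each of the first k blocks with error proportional
   to eps (|x_j| / mu_j), after quantizing (|x_j| / mu_j)^2, and approximate the
   remaining blocks by 0, which costs |x_j| <= eps (|x_j| / mu_j).  The squared
   errors then add up to essentially eps^2, and each block contributes only a
   power of (dbar d k)^gamma besides the factor (mu_j / eps)^(d_j). *)

(** * Inner products and squared norms of row vectors *)

Section Euclid.
Context {R : realType} {n : nat}.
Implicit Types (x y z : 'rV[R]_n) (a b : R).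

Definition dot x y : R := \sum_(i < n) x ord0 i * y ord0 i.
Definition sqn x : R := \sum_(i < n) x ord0 i ^+ 2.

Lemma dotxx x : dot x x = sqn x.
Proof. by apply: eq_bigr => i _; rewrite expr2. Qed.

Lemma dotC x y : dot x y = dot y x.
Proof. by apply: eq_bigr => i _; rewrite mulrC. Qed.

Lemma dotDl x y z : dot (x + y) z = dot x z + dot y z.
Proof. by rewrite -big_split; apply: eq_bigr => i _; rewrite mxE mulrDl. Qed.

Lemma dotZl a x y : dot (a *: x) y = a * dot x y.
Proof. by rewrite mulr_sumr; apply: eq_bigr => i _; rewrite mxE mulrA. Qed.

Lemma sqn_ge0 x : 0 <= sqn x.
Proof. by apply: sumr_ge0 => i _; rewrite sqr_ge0. Qed.

Lemma sqnZ a x : sqn (a *: x) = a ^+ 2 * sqn x.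
Proof. by rewrite mulr_sumr; apply: eq_bigr => i _; rewrite mxE exprMn. Qed.

Lemma sqnD x y : sqn (x + y) = sqn x + 2 * dot x y + sqn y.
Proof. by rewrite -!dotxx !(dotDl, dotC _ (x + y)) (dotC y x); ring. Qed.

Lemma sqn_distC x y : sqn (x - y) = sqn (y - x).
Proof. by rewrite -opprB -[- (y - x)]scaleN1r sqnZ sqrrN expr1n mul1r. Qed.

Lemma sqn_scaleD a b x y :
  sqn (a *: x + b *: y) = a ^+ 2 * sqn x + 2 * a * b * dot x y + b ^+ 2 * sqn y.
Proof. by rewrite sqnD !sqnZ dotZl dotC dotZl dotC; ring. Qed.

(** Cauchy-Schwarz: expand the nonnegative squared norms of [b *: x + a *: y] and
    [b *: x - a *: y]. *)
Lemma norm_dot_le a b x y : 0 < a -> 0 < b ->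
  sqn x <= a ^+ 2 -> sqn y <= b ^+ 2 -> `|dot x y| <= a * b.
Proof.
move=> a0 b0 xa yb; rewrite ler_norml.
have ab0 : 0 < a * b by exact: mulr_gt0.
have hp := sqn_ge0 (b *: x + a *: y).
have hm := sqn_ge0 (b *: x + (- a) *: y).
rewrite !sqn_scaleD in hp hm.
have hx : b ^+ 2 * sqn x <= b ^+ 2 * a ^+ 2 by rewrite ler_wpM2l ?sqr_ge0.
have hy : a ^+ 2 * sqn y <= b ^+ 2 * a ^+ 2.
  by rewrite [leRHS]mulrC ler_wpM2l ?sqr_ge0.
apply/andP; split; rewrite -(ler_pM2l ab0); nra.
Qed.

Lemma sqnD_le a b x y : 0 < a -> 0 < b ->
  sqn x <= a ^+ 2 -> sqn y <= b ^+ 2 -> sqn (x + y) <= (a + b) ^+ 2.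
Proof.
move=> a0 b0 xa yb; have := norm_dot_le a0 b0 xa yb.
by rewrite sqnD ler_norml => /andP[_]; lra.
Qed.

Lemma sqn_eq0 x : sqn x = 0 -> x = 0.
Proof.
move=> /eqP; rewrite psumr_eq0 => [/allP x0|i _]; last exact: sqr_ge0.
apply/rowP => i; rewrite mxE; apply/eqP.
by have := x0 i (mem_index_enum i); rewrite sqrf_eq0.
Qed.

Lemma polar x : (0 < n)%N -> exists a u,
  [/\ 0 <= a, a ^+ 2 = sqn x, sqn u = 1 & x = a *: u].
Proof.
move=> n0; have [x0|x0] := eqVneq (sqn x) 0.
  exists 0, (delta_mx ord0 (Ordinal n0)); rewrite x0 (sqn_eq0 x0) scale0r expr0n.
  split=> //; rewrite /sqn (bigD1 (Ordinal n0)) //= !mxE !eqxx expr1n.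
  by rewrite big1 ?addr0// => i /negPf; rewrite !mxE eqxx /= => ->; rewrite expr0n.
have a0 : Num.sqrt (sqn x) != 0.
  by rewrite gt_eqF// sqrtr_gt0 lt_neqAle eq_sym x0 sqn_ge0.
exists (Num.sqrt (sqn x)), ((Num.sqrt (sqn x))^-1 *: x).
rewrite sqrtr_ge0 sqr_sqrtr ?sqn_ge0// sqnZ exprVn sqr_sqrtr ?sqn_ge0//.
by rewrite mulVf// scalerA divff// scale1r.
Qed.

End Euclid.

(** * Lattice points in balls *)

Section Lattice.
Context {R : realType}.

(** Rounding toward zero never increases the absolute value, so rounding a point of a centred ball
    coordinatewise keeps it in the ball. *)
Definition toward0 (x : R) : int :=
  if 0 <= x then Posz (Num.truncn x) else - Posz (Num.truncn (- x)).

Lemma toward0P (x : R) :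
  (toward0 x)%:~R ^+ 2 <= (toward0 x)%:~R * x /\ `|x - (toward0 x)%:~R| <= 1.
Proof.
rewrite /toward0 ler_norml; have [x0|x0] := leP 0 x.
  have /andP[] := truncn_itv x0; rewrite -natr1 -pmulrn.
  have := ler0n R (Num.truncn x); move: (_%:R) => t t0 h1 h2.
  split; last by lra.
  by rewrite expr2 ler_wpM2l.
have nx0 : 0 <= - x by rewrite oppr_ge0 ltW.
have /andP[] := truncn_itv nx0; rewrite -natr1 mulrNz -pmulrn.
have := ler0n R (Num.truncn (- x)); move: (_%:R) => t t0 h1 h2.
by split; [nra|lra].
Qed.

Lemma norm_toward0_le (x : R) (m : nat) :
  `|x| <= m%:R -> (`|toward0 x| <= m)%N.
Proof.
move=> xm; have [h _] := toward0P x.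
rewrite -(ler_nat R) natr_absz intr_norm; apply: le_trans xm.
have [->|t0] := eqVneq ((toward0 x)%:~R : R) 0; first by rewrite normr0.
have t0' : 0 < `|(toward0 x)%:~R : R| by rewrite normr_gt0.
rewrite -(ler_pM2l t0') -normrM -expr2 -normrM ger0_norm ?sqr_ge0//.
exact: le_trans h (ler_norm _).
Qed.

Section Dim.
Context {n : nat}.

Definition rvec (z : 'rV[int]_n) : 'rV[R]_n := map_mx intr z.

Lemma lattice_approx (x : 'rV[R]_n) : exists z : 'rV[int]_n,
  sqn (rvec z) <= sqn x /\ sqn (x - rvec z) <= n%:R ^+ 2.
Proof.
exists (\row_i toward0 (x ord0 i)); split.
  apply: ler_sum => i _; rewrite !mxE.
  by have [h _] := toward0P (x ord0 i); nra.
(* Each coordinate contributes at most 1; the sum [n] is weakened to [n ^ 2] to avoid square roots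
   later. *)
apply: (@le_trans _ _ (\sum_(i < n) 1)); last first.
  rewrite sumr_const card_ord -natrX ler_nat.
  by case: (n) => // k; rewrite -mulnn leq_pmulr.
apply: ler_sum => i _; rewrite !mxE.
by have [_ h] := toward0P (x ord0 i); rewrite -real_normK ?num_real// expr_le1.
Qed.

Definition lbox (m : nat) : seq 'rV[int]_n :=
  [seq \row_i (Posz (f i) - Posz m) | f : {ffun 'I_n -> 'I_(m.*2.+1)}].

Lemma uniq_lbox m : uniq (lbox m).
Proof.
rewrite map_inj_uniq ?enum_uniq// => f g /rowP fg; apply/ffunP => i.
by have := fg i; rewrite !mxE => /addIr [] /val_inj.
Qed.

Lemma size_lbox m : size (lbox m) = (m.*2.+1 ^ n)%N.
Proof. by rewrite size_map -cardE card_ffun !card_ord. Qed.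

Lemma mem_lbox m (z : 'rV[int]_n) : (forall i, (`|z ord0 i| <= m)%N) -> z \in lbox m.
Proof.
move=> zm; apply/mapP; exists [ffun i => inord (absz (z ord0 i + m))].
  by rewrite mem_enum.
apply/rowP => i; rewrite mxE ffunE; have := zm i; move: (z ord0 i) => c cm.
by rewrite inordK; lia.
Qed.

Definition lball (r : R) : seq 'rV[int]_n :=
  [seq z <- lbox (Num.truncn r) | sqn (rvec z) <= r ^+ 2].

Lemma mem_lball r z : 0 <= r -> (z \in lball r) = (sqn (rvec z) <= r ^+ 2).
Proof.
move=> r0; rewrite mem_filter; case: (boolP (_ <= _)) => //= zr.
apply: mem_lbox => i; rewrite truncn_ge_nat// natr_absz intr_norm.
rewrite -(@ler_pXn2r _ 2)// ?nnegrE// real_normK ?num_real//.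
apply: le_trans zr; rewrite /sqn (bigD1 i)//= mxE lerDl.
by apply: sumr_ge0 => j _; exact: sqr_ge0.
Qed.

Lemma size_lball_le r : 0 <= r -> (size (lball r))%:R <= (2 * r + 1) ^+ n.
Proof.
move=> r0; apply: (@le_trans _ _ ((Num.truncn r).*2.+1 ^ n)%N%:R).
  by rewrite ler_nat size_filter -size_lbox count_size.
rewrite natrX lerXn2r ?nnegrE//; first by rewrite addr_ge0// mulr_ge0.
by rewrite -natr1 -muln2 natrM mulrC lerD2r ler_wpM2l// truncn_le.
Qed.

Lemma size_lball_ge1 r : 0 <= r -> (1 <= size (lball r))%N.
Proof.
move=> r0; have : 0 \in lball r.
  rewrite mem_lball// /sqn big1 ?sqr_ge0// => i _.
  by rewrite !mxE expr0n.
by case: (lball r).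
Qed.

(* The count of lattice points grows like r^n, so it cannot exceed twice that
   rate at every scale. *)
Lemma lball_growth (t r0 : R) : 1 < t -> 1 <= r0 -> exists2 r, r0 <= r &
  (size (lball (t * r)))%:R <= 2 * t ^+ n * (size (lball r))%:R.
Proof.
move=> t1 r01; apply: contrapT => /forall2NP H.
have t0 : 0 < t by lra.
(* If the bound failed at every radius from [r0] on, the counts at [t ^+ j * r0] would grow like
   this, while the enclosing cube allows only [(3 * t ^+ j * r0) ^+ n]; cancelling would leave
   [2 ^+ j] bounded in [j]. *)
have V j : (2 * t ^+ n) ^+ j <= (size (lball (t ^+ j * r0)))%:R.
  elim: j => [|j IH].
    by rewrite !expr0 mul1r ler1n size_lball_ge1; lra.
  have [|/negP] := H (t ^+ j * r0).
    by have : 1 <= t ^+ j by [rewrite exprn_ege1// ltW]; nra.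
  rewrite -ltNge mulrA -exprS => /ltW; apply: le_trans.
  by rewrite exprS ler_wpM2l// mulr_ge0// exprn_ge0// ltW.
have {}V j : 2 ^+ j <= (3 * r0) ^+ n.
  have tj : 1 <= t ^+ j by rewrite exprn_ege1// ltW.
  have tj0 : 0 < (t ^+ j) ^+ n by rewrite exprn_gt0//; lra.
  rewrite -(ler_pM2r tj0) -exprMn -exprM mulnC exprM -exprMn.
  apply: (le_trans (V j)); apply: (le_trans (size_lball_le _)).
    by rewrite mulr_ge0//; lra.
  by rewrite lerXn2r ?nnegrE//; nra.
have := V (Num.truncn ((3 * r0) ^+ n)).+1; apply/negP; rewrite -ltNge.
apply: lt_trans (truncnS_gt _) _.
by rewrite -natrX ltr_nat ltn_expl.
Qed.

End Dim.
End Lattice.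

(** * Pigeonhole principles *)

Lemma pigeonhole (T : Type) (k : nat) (f : T -> 'I_k.+1) (s : seq T) :
  exists i, (size s <= k.+1 * count (fun z => f z == i) s)%N.
Proof.
have sizeE : size s = \sum_i count (fun z => f z == i) s.
  elim: s => [|z s IH] /=; first by rewrite big1.
  by rewrite big_split/= -IH (bigD1 (f z))//= eqxx big1 ?addn0// => i /negPf;
    rewrite eq_sym => ->.
pose i0 := [arg max_(i > ord0) count (fun z => f z == i) s]%N.
exists i0; rewrite sizeE -[X in (_ <= X * _)%N]card_ord -sum_nat_const.
by apply: leq_sum => i _; rewrite /i0; case: arg_maxnP => // j _; exact.
Qed.

Lemma pigeonhole_int (T : eqType) (m : nat) (f : T -> int) (s : seq T) :
  (forall z, z \in s -> (`|f z| <= m)%N) ->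
  exists b, (size s <= m.*2.+1 * count (fun z => f z == b) s)%N.
Proof.
move=> fm; pose g z : 'I_m.*2.+1 := inord (absz (f z + Posz m)).
have [i hi] := pigeonhole g s; exists (Posz i - Posz m).
apply: leq_trans hi _; rewrite leq_mul2l; apply/orP; right.
rewrite -!size_filter; apply: eq_leq; congr size.
apply: eq_in_filter => z /fm zm; apply/eqP/eqP => [<-|fz].
  by rewrite /g inordK; lia.
by apply: val_inj; rewrite /= inordK; lia.
Qed.

(** * How many lattice centres are close to a given point *)

Section Density.
Context {R : realType}.

Lemma bernoulli (a : R) n : -1 <= a -> 1 + n%:R * a <= (1 + a) ^+ n.
Proof.
move=> a1; elim: n => [|n IH]; first by rewrite mul0r addr0 expr0.
rewrite exprS -natr1; apply: (@le_trans _ _ ((1 + a) * (1 + n%:R * a))).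
  by have := ler0n R n; nra.
by rewrite ler_wpM2l//; lra.
Qed.

(** By Bernoulli [(1 - a) ^+ n] is at least 1/2, and its product with [(1 + a) ^+ n] is at most
    1. *)
Lemma exp1D_le2 (a : R) n : 0 <= a -> 2 * n%:R * a <= 1 -> (1 + a) ^+ n <= 2.
Proof.
move=> a0 na; case: n na => [|n] na; first by rewrite expr0; lra.
have a1 : a <= 1 by have := ler0n R n; move: na; rewrite -natr1; nra.
have h1 : 1 + n.+1%:R * (- a) <= (1 + - a) ^+ n.+1 by apply: bernoulli; lra.
have h2 : (1 + a) ^+ n.+1 * (1 + - a) ^+ n.+1 <= 1.
  by rewrite -exprMn expr_le1//; nra.
have : 0 <= (1 + a) ^+ n.+1 by rewrite exprn_ge0//; lra.
by nra.
Qed.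

(* Write x = a u with u of norm 1.  The centres counted are the points of the
   lattice, scaled by L^-1, next to (1 - tau^-2) x + z - (b sig / m) u, where z
   ranges over the ball of radius sig, b is v := <z, u> m / sig rounded toward 0,
   and z is restricted to the most populated class of b.  Since b v >= b^2,
   subtracting (b sig / m) u does not increase the norm of z, and it moves the
   slab to the centre of the ball. *)
Lemma density_count n (tau sig L : R) (m : nat) (x : 'rV[R]_n) :
  (0 < n)%N -> (0 < m)%N -> 1 < tau -> 0 < sig -> sig ^+ 2 = 1 - tau ^- 2 ->
  n%:R * m%:R <= L * sig -> sqn x <= tau ^+ 2 ->
  (size (@lball R n (L * sig)) <= m.*2.+1 * count
     (fun z => (sqn (x - L^-1 *: rvec z) <= (1 + 2 * m%:R^-1) ^+ 2)%R)
     (@lball R n (tau * (1 + 2 * m%:R^-1) * (L * sig))))%N.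
Proof.
move=> n0 m0 t1 sig0 sig2; have [r LS] : exists r, r = L * sig by exists (L * sig).
rewrite -LS => rnm xt.
have m0' : 0 < m%:R :> R by rewrite ltr0n.
have n0' : 0 < n%:R :> R by rewrite ltr0n.
have [eta etaE] : exists eta : R, m%:R^-1 = eta by exists m%:R^-1.
have eta0 : 0 < eta by rewrite -etaE invr_gt0.
have etam : eta * m%:R = 1 by rewrite -etaE mulVf// gt_eqF.
rewrite etaE => {etaE}.
have r0 : 0 < r by apply: lt_le_trans rnm; exact: mulr_gt0.
have t0 : 0 < tau by lra.
have [it itE] : exists it : R, tau^-1 = it by exists tau^-1.
have it0 : 0 < it by rewrite -itE invr_gt0.
have tit : tau * it = 1 by rewrite -itE divff// gt_eqF.
rewrite -exprVn itE in sig2.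
have sig1 : sig < 1 by nra.
have L0 : 0 < L by rewrite -(pmulr_lgt0 _ sig0) -LS.
have nr : n%:R <= r * eta by rewrite -(ler_pM2r m0') -mulrA etam mulr1.
have [a [u [a0 a2 u1 ->]]] := polar x n0.
have at_ : a <= tau by rewrite -(@ler_pXn2r _ 2)// ?nnegrE// ?a2//; lra.
have re0 : 0 < r * eta by exact: mulr_gt0.
(* Signed height of [z] along [u], in units of the slab half-width [r * eta]. *)
pose v z := dot (rvec z) u / (r * eta).
have vE z : dot (rvec z) u = v z * (r * eta) by rewrite divfK// gt_eqF.
have vm z : z \in lball r -> `|v z| <= m%:R.
  rewrite (mem_lball _ (ltW r0)) => zr.
  rewrite normrM [`|(r * eta)^-1|]gtr0_norm ?invr_gt0// ler_pdivrMr//.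
  rewrite mulrCA [_ * eta]mulrC etam; apply: norm_dot_le => //.
  by rewrite u1 expr1n.
have [b hb] := @pigeonhole_int _ m (toward0 \o v) (lball r)
  (fun z zr => norm_toward0_le (vm z zr)).
apply: (leq_trans hb); rewrite leq_mul2l; apply/orP; right.
(* Translation by a lattice vector [w] is injective, so it is enough that it sends the chosen class
   into the counted set. Rounding the desired translation [q] to [w] costs at most [n], hence at
   most [r * eta]. *)
have [w [_ wq]] := lattice_approx
  ((L * sig ^+ 2 * a) *: u - (b%:~R * (r * eta)) *: u).
rewrite -!size_filter -(size_map (fun z => z + w)).
apply: uniq_leq_size.
  by rewrite map_inj_uniq ?filter_uniq ?uniq_lbox// => z1 z2 /addIr.
move=> _ /mapP[z + ->]; rewrite mem_filter => /andP[/eqP/= bz zr].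
have [] := toward0P (v z); rewrite bz => b1 b2.
move: zr; rewrite (mem_lball _ (ltW r0)) => zr.
have rvD : rvec (z + w) = rvec z + rvec w :> 'rV[R]_n by exact: map_mxD.
set q := (_ *: u - _ *: u) in wq.
set z' := rvec z - (b%:~R * (r * eta)) *: u.
have z'1 : sqn z' <= r ^+ 2.
  apply: le_trans zr; rewrite /z' -[rvec z]scale1r -scaleNr sqn_scaleD u1 vE scale1r.
  rewrite -subr_ge0.
  by rewrite (_ : _ - _ = (r * eta) ^+ 2 * (2 * (b%:~R * v z) - b%:~R ^+ 2));
    [rewrite mulr_ge0 ?sqr_ge0//; have := sqr_ge0 (b%:~R : R); lra|ring].
have z'2 : `|dot z' u| <= r * eta.
  rewrite /z' dotDl -scaleNr dotZl dotxx u1 vE mulr1 -mulrBl normrM.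
  by rewrite [`|r * eta|]gtr0_norm// ler_piMl// ltW.
have nre : sqn (rvec w - q) <= (r * eta) ^+ 2.
  rewrite sqn_distC.
  by apply: le_trans wq _; rewrite lerXn2r ?nnegrE// ltW.
have zwE : rvec z + rvec w = (z' + (L * sig ^+ 2 * a) *: u) + (rvec w - q).
  by rewrite /z' /q; apply/rowP => i; rewrite !mxE; ring.
rewrite mem_filter mem_lball; last by rewrite !mulr_ge0 ?addr_ge0 ?ltW//; lra.
move: z'2; rewrite ler_norml => /andP[z'2 z'3].
apply/andP; split.
  (* Distance to [x], scaled by [L]: the shift leaves [L * a * it ^+ 2] of [x] along [u]. The
     squares of this and of [z'] add up to at most [L ^+ 2], the thin slab bounds the cross term,
     and rounding adds at most [L * eta]. *)
  rewrite -(ler_pM2l (exprn_gt0 2 L0)) -sqnZ scalerBr !scalerA divff ?gt_eqF//.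
  rewrite scale1r rvD zwE -exprMn.
  rewrite (_ : _ - _ = ((L * a * it ^+ 2) *: u + (-1) *: z') + (q - rvec w)); last first.
    apply/rowP => i; rewrite !mxE sig2; ring.
  rewrite (_ : L * (1 + 2 * eta) = L * (1 + eta) + L * eta); last by ring.
  apply: sqnD_le; rewrite ?mulr_gt0//; first by lra.
    rewrite sqn_scaleD u1 dotC mulr1 sqrrN expr1n mul1r.
    have p0 : 0 <= L * a * it ^+ 2 by rewrite !mulr_ge0 ?sqr_ge0// ltW.
    have p1 : L * a * it ^+ 2 <= L * it.
      by rewrite expr2 mulrA ler_pM2r// -mulrA ler_piMr ?(ltW L0)// -tit ler_pM2r.
    have p2 : (L * a * it ^+ 2) ^+ 2 <= (L * it) ^+ 2.
      by rewrite lerXn2r ?nnegrE// mulr_ge0// ltW.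
    have h1 : L * a * it ^+ 2 * - dot z' u <= L * it * (r * eta).
      by apply: (le_trans (y := L * a * it ^+ 2 * (r * eta)));
        [rewrite ler_wpM2l//; lra | rewrite ler_wpM2r// ltW].
    have h2 : L * it * (r * eta) <= L ^+ 2 * eta.
      rewrite LS (_ : L * it * (L * sig * eta) = L ^+ 2 * eta * (it * sig)); last by ring.
      by rewrite ler_piMr ?mulr_ge0 ?sqr_ge0 ?(ltW eta0)//; nra.
    have h3 : sqn z' <= L ^+ 2 * (1 - it ^+ 2) by rewrite -sig2 -exprMn -LS.
    have := mulr_ge0 (sqr_ge0 L) (sqr_ge0 eta).
    nra.
  rewrite sqn_distC; apply: le_trans nre _.
  by rewrite lerXn2r ?nnegrE ?(ltW re0) ?mulr_ge0 ?ltW// LS; nra.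
(* Norm of the centre: [r ^+ 2 + (r * sig * tau) ^+ 2 = (tau * r) ^+ 2], again up to a cross term
   bounded by the slab and the rounding error. *)
rewrite rvD zwE.
apply: (@le_trans _ _ ((tau * r * (1 + eta) + r * eta) ^+ 2)).
  apply: sqnD_le => //; first by rewrite !mulr_gt0//; lra.
  rewrite -[z']scale1r sqn_scaleD u1 expr1n mulr1 mul1r mulr1.
  have p0 : 0 <= L * sig ^+ 2 * a by rewrite !mulr_ge0 ?sqr_ge0// ltW.
  have p1 : L * sig ^+ 2 * a <= r * sig * tau.
    by rewrite LS -(mulrA L sig sig) -expr2 ler_wpM2l// mulr_ge0 ?sqr_ge0 ?(ltW L0).
  have p2 : (L * sig ^+ 2 * a) ^+ 2 <= (r * sig * tau) ^+ 2.
    by rewrite lerXn2r ?nnegrE// !mulr_ge0// ltW.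
  have h1 : L * sig ^+ 2 * a * dot z' u <= r * sig * tau * (r * eta).
    by apply: (le_trans (y := L * sig ^+ 2 * a * (r * eta)));
      [rewrite ler_wpM2l | rewrite ler_wpM2r// ltW].
  have h2 : r * sig * tau * (r * eta) <= r ^+ 2 * tau ^+ 2 * eta.
    rewrite (_ : r * sig * tau * (r * eta) = r ^+ 2 * tau * eta * sig); last by ring.
    rewrite (_ : r ^+ 2 * tau ^+ 2 * eta = r ^+ 2 * tau * eta * tau); last by ring.
    by rewrite ler_wpM2l ?mulr_ge0 ?sqr_ge0 ?ltW//; lra.
  have h3 : (r * sig * tau) ^+ 2 = r ^+ 2 * (tau ^+ 2 - 1).
    by rewrite -[in RHS](expr1n _ 2) -tit !exprMn sig2; ring.
  have := mulr_ge0 (mulr_ge0 (sqr_ge0 r) (sqr_ge0 tau)) (sqr_ge0 eta).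
  nra.
rewrite lerXn2r ?nnegrE//.
- by rewrite addr_ge0 ?mulr_ge0 ?ltW//; lra.
- by rewrite !mulr_ge0 ?ltW//; lra.
by suff : r * eta <= tau * r * eta; [lra|rewrite ler_pM2r// ler_peMl// ltW].
Qed.

End Density.

(** * Covering a ball *)

Section BallCover.
Context {R : realType}.

(** [lball_growth] supplies a radius [r] at which enlarging the ball by [tau * (1 + 2 / m)]
    multiplies the count by little more than the volume ratio; [density_count] then compares the
    small ball with the centres near [x]. *)
Lemma lattice_density n (tau : R) (m : nat) :
  (0 < n)%N -> (4 * n <= m)%N -> 1 < tau ->
  exists2 Y : seq 'rV[R]_n, (0 < size Y)%N & forall x, sqn x <= tau ^+ 2 ->
    (size Y)%:R <= 12 * m%:R * tau ^+ n *
      (count (fun y => sqn (x - y) <= (1 + 2 * m%:R^-1) ^+ 2) Y)%:R.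
Proof.
move=> n0 nm t1.
have m0 : (0 < m)%N by lia.
have m0' : 0 < m%:R :> R by rewrite ltr0n.
have im0 : 0 < m%:R^-1 :> R by rewrite invr_gt0.
have t0 : 0 < tau by lra.
pose sig := Num.sqrt (1 - tau ^- 2).
have it1 : tau ^- 2 < 1 by rewrite invf_lt1 ?exprn_gt0// expr_gt1 // ltW.
have sig0 : 0 < sig by rewrite sqrtr_gt0 subr_gt0.
have sig2 : sig ^+ 2 = 1 - tau ^- 2 by rewrite sqr_sqrtr// subr_ge0 ltW.
have t'1 : 1 < tau * (1 + 2 * m%:R^-1) by nra.
have nm1 : 1 <= n%:R * m%:R :> R by rewrite -natrM ler1n muln_gt0 n0.
have [r rnm hr] := @lball_growth R n _ _ t'1 nm1.
have LS : r / sig * sig = r by rewrite divfK// gt_eqF.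
exists [seq (r / sig)^-1 *: rvec z | z <- lball (tau * (1 + 2 * m%:R^-1) * r)].
  by rewrite size_map size_lball_ge1// !mulr_ge0//; lra.
move=> x xt; rewrite size_map count_map.
have := @density_count R n tau sig (r / sig) m x n0 m0 t1 sig0 sig2.
rewrite LS => /(_ rnm xt); rewrite -(ler_nat R) natrM => hc.
apply: le_trans hr _; rewrite exprMn.
(* Since [4 * n <= m], the enlargement costs only a factor 2; with 2 from the growth bound and 3
   from [m.*2.+1] this makes the constant 12. *)
have e2 : (1 + 2 * m%:R^-1) ^+ n <= 2 :> R.
  apply: exp1D_le2; first by lra.
  rewrite mulrA ler_pdivrMr// mul1r -!natrM ler_nat; lia.
have m3 : m.*2.+1%:R <= 3 * m%:R :> R by rewrite -natrM ler_nat; lia.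
have tn : 0 < tau ^+ n by exact: exprn_gt0.
move: hc; rewrite /= /preim /=; set c := (count _ _)%:R => hc.
have c0 : 0 <= c by exact: ler0n.
have {}hc : (size (lball (n := n) r))%:R <= 3 * m%:R * c.
  by apply: (le_trans hc); rewrite ler_wpM2r.
apply: (@le_trans _ _ (2 * (tau ^+ n * 2) * (3 * m%:R * c))); last by lra.
apply: ler_pM => //.
  by rewrite !mulr_ge0// ?exprn_ge0//; lra.
by rewrite ler_wpM2l// ler_wpM2l// ltW.
Qed.

(** * Greedy selection of centres by double counting *)

Section Greedy.
Variables (T1 T2 : eqType) (rel : T1 -> T2 -> bool) (Y : seq T2) (P : R).
Hypothesis Y0 : (0 < size Y)%N.

Lemma double_count (U : seq T1) :
  (\sum_(y <- Y) count (rel^~ y) U = \sum_(x <- U) count (rel x) Y)%N.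
Proof.
under eq_bigr do rewrite -sum1_count big_mkcond.
under [RHS]eq_bigr do rewrite -sum1_count big_mkcond.
by rewrite exchange_big.
Qed.

(** Averaging over [Y]: if every [y] were related to less than a fraction [P^-1] of [U], counting
    the related pairs the other way would contradict the hypothesis. *)
Lemma greedy_step (U : seq T1) :
  (forall x, x \in U -> (size Y)%:R <= P * (count (rel x) Y)%:R) ->
  exists y, (size U)%:R <= P * (count (rel^~ y) U)%:R.
Proof.
move=> hU; apply: contrapT => /forallNP H.
have : \sum_(y <- Y) P * (count (rel^~ y) U)%:R < \sum_(y <- Y) (size U)%:R.
  case: (Y) Y0 => // y0 Y' _; rewrite !big_cons; apply: ltr_leD.
    by have /negP := H y0; rewrite -ltNge.
  by apply: ler_sum => y _; have /negP := H y; rewrite -ltNge => /ltW.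
apply/negP; rewrite -leNgt -mulr_sumr -!natr_sum double_count.
rewrite [X in _ <= P * X]natr_sum mulr_sumr [leRHS]big_seq.
apply: le_trans (ler_sum _ hU); rewrite -big_seq -natr_sum ler_nat.
by rewrite !big_const_seq !count_predT !iter_addn_0 mulnC.
Qed.

(** Each chosen centre removes a fraction at least [P^-1] of the remaining points, and the
    hypothesis is inherited by what remains because [Y] stays fixed. *)
Lemma greedy (M : nat) (U : seq T1) : 1 <= P ->
  (forall x, x \in U -> (size Y)%:R <= P * (count (rel x) Y)%:R) ->
  exists2 S : seq T2, (size S <= M)%N &
    (size [seq x <- U | ~~ has (rel x) S])%:R <= (1 - P^-1) ^+ M * (size U)%:R.
Proof.
move=> P1; elim: M U => [|M IH] U hU.
  exists [::] => //; rewrite expr0 mul1r ler_nat size_filter; exact: count_size.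
have [y hy] := greedy_step hU.
have [|S SM hS] := IH [seq x <- U | ~~ rel x y].
  by move=> x; rewrite mem_filter => /andP[_]; exact: hU.
exists (y :: S) => //.
have -> : [seq x <- U | ~~ has (rel x) (y :: S)] =
          [seq x <- [seq x <- U | ~~ rel x y] | ~~ has (rel x) S].
  by rewrite -filter_predI; apply: eq_filter => x /=; rewrite negb_or andbC.
apply: le_trans hS _; rewrite exprSr -mulrA.
have P0 : 0 < P by lra.
apply: ler_wpM2l; first by rewrite exprn_ge0// subr_ge0 invf_le1.
rewrite mulrBl mul1r lerBrDr -lerBrDl ler_pdivrMl//.
apply: le_trans hy _; rewrite ler_pM2l// size_filter.
by rewrite -(count_predC (rel^~ y) U) natrD addrK.
Qed.

End Greedy.

(** [(1 - P^-1) ^+ q] is at most the inverse of [(1 + P^-1) ^+ q], which is at least 2 by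
    Bernoulli. *)
Lemma exp_decay (P : R) (q j : nat) : 1 <= P -> P <= q%:R ->
  (1 - P^-1) ^+ (q * j) <= 2 ^- j.
Proof.
move=> P1 Pq; rewrite exprM -exprVn.
have P0 : 0 < P by lra.
have iP0 : 0 < P^-1 by rewrite invr_gt0.
have iP1 : P^-1 <= 1 by rewrite invf_le1.
rewrite lerXn2r ?nnegrE ?exprn_ge0 ?invr_ge0 ?subr_ge0//.
rewrite -[2^-1]mul1r ler_pdivlMr//.
have h : (1 - P^-1) ^+ q * (1 + P^-1) ^+ q <= 1.
  by rewrite -exprMn exprn_ile1//; nra.
apply: le_trans h; apply: ler_wpM2l; first by rewrite exprn_ge0 ?subr_ge0.
apply: le_trans (bernoulli _ _); last by lra.
suff : 1 <= q%:R * P^-1 by lra.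
by rewrite ler_pdivlMr// mul1r.
Qed.

Lemma ball_cover n (tau : R) (m : nat) :
  (0 < n)%N -> (4 * n <= m)%N -> 1 < tau ->
  exists2 C : seq 'rV[R]_n,
    (size C)%:R <= 40 * m%:R ^+ 2 * n%:R ^+ 2 * tau ^+ n &
    forall x, sqn x <= tau ^+ 2 ->
      exists2 c, c \in C & sqn (x - c) <= (1 + 3 * m%:R^-1) ^+ 2.
Proof.
move=> n0 nm t1; have [Y Y0 hY] := lattice_density n0 nm t1.
have m0 : (0 < m)%N by lia.
have m0' : 0 < m%:R :> R by rewrite ltr0n.
have n0' : 0 < n%:R :> R by rewrite ltr0n.
have n1' : 1 <= n%:R :> R by rewrite ler1n.
have m4 : 4 <= m%:R :> R by rewrite ler_nat; lia.
have im0 : 0 < m%:R^-1 :> R by rewrite invr_gt0.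
have t0 : 0 < tau by lra.
have tn1 : 1 <= tau ^+ n by rewrite exprn_ege1// ltW.
have nm0 : 0 < n%:R * m%:R :> R by exact: mulr_gt0.
(* A net: lattice rounding costs at most [n], so after scaling every point of the ball of radius
   [tau] is within [1 / m] of [X]. *)
pose X : seq 'rV[R]_n :=
  [seq (n%:R * m%:R)^-1 *: rvec z | z <- @lball R n (tau * (n%:R * m%:R))].
pose P := 12 * m%:R * tau ^+ n.
have P1 : 1 <= P by rewrite /P; nra.
pose q := (Num.truncn P).+1.
have Pq : P <= q%:R by rewrite ltW// truncnS_gt.
(* Chosen so that [2 ^ j = (2 ^ (3 * n * m)) ^ n] exceeds [(3 * n * m) ^ n]: then at most [tau ^+ n]
   net points remain uncovered. *)
pose j := (3 * n * m * n)%N.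
have [x|S SM hS] := @greedy _ _
  (fun x y : 'rV[R]_n => sqn (x - y) <= (1 + 2 * m%:R^-1) ^+ 2) Y P Y0 (q * j) X P1.
  move=> /mapP[z + ->]; rewrite mem_lball => [zt|]; last by rewrite mulr_ge0// ltW.
  apply: hY; rewrite sqnZ exprVn ler_pdivrMl ?exprn_gt0//.
  by rewrite -exprMn mulrC.
set W := [seq x <- X | _] in hS; exists (S ++ W).
  have sW : (size W)%:R <= tau ^+ n.
    apply: le_trans hS _.
    apply: (@le_trans _ _ (2 ^- j * (3 * (n%:R * m%:R) * tau) ^+ n)).
      apply: ler_pM => //; first by rewrite exprn_ge0// subr_ge0 invf_le1//; lra.
        exact: exp_decay.
      rewrite size_map; apply: le_trans (size_lball_le _) _.
        by rewrite mulr_ge0// ltW.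
      have : 1 <= n%:R * m%:R * tau by nra.
      by rewrite lerXn2r ?nnegrE//; nra.
    rewrite exprMn !mulrA ler_piMl// ?(le_trans _ tn1)//.
    rewrite ler_pdivrMl ?exprn_gt0// mulr1 /j exprM.
    rewrite lerXn2r ?nnegrE ?mulr_ge0// ?exprn_ge0//.
    rewrite -!natrM -natrX ler_nat; apply: ltnW; exact: ltn_expl.
  have sS : (size S)%:R <= (P + 1) * (3 * n%:R * m%:R * n%:R).
    apply: (@le_trans _ _ (q * j)%N%:R); first by rewrite ler_nat.
    rewrite natrM /j !natrM ler_wpM2r ?mulr_ge0// -natr1 lerD2r truncn_le; lra.
  rewrite size_cat natrD; apply: le_trans (lerD sS sW) _; rewrite /P.
  have h1 : 3 * n%:R * m%:R * n%:R <= n%:R ^+ 2 * m%:R ^+ 2 * tau ^+ n :> R.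
    have h3 : 3 * m%:R <= m%:R ^+ 2 * tau ^+ n :> R by nra.
    by have := ler_wpM2l (sqr_ge0 n%:R) h3; lra.
  have h2 : tau ^+ n <= n%:R ^+ 2 * m%:R ^+ 2 * tau ^+ n.
    by rewrite ler_peMl ?(le_trans _ tn1)// -exprMn expr_ge1 ?mulr_ge0//; nra.
  nra.
move=> x xt; have [z [z1 z2]] := lattice_approx ((n%:R * m%:R) *: x).
pose x' := (n%:R * m%:R)^-1 *: rvec z : 'rV[R]_n.
have x'X : x' \in X.
  apply: map_f; rewrite mem_lball; last by rewrite mulr_ge0// ltW.
  by apply: le_trans z1 _; rewrite sqnZ [leRHS]exprMn [leLHS]mulrC ler_wpM2r ?sqr_ge0.
have xx' : sqn (x - x') <= m%:R^-1 ^+ 2.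
  rewrite -(ler_pM2l (exprn_gt0 2 nm0)) -sqnZ scalerBr scalerA divff ?gt_eqF//.
  by rewrite scale1r -exprMn mulfK ?gt_eqF.
have [/hasP[c cS xc]|x'S] := boolP
   (has (fun y => sqn (x' - y) <= (1 + 2 * m%:R^-1) ^+ 2) S).
  exists c; first by rewrite mem_cat cS.
  rewrite (_ : x - c = (x - x') + (x' - c)); last by rewrite addrA subrK.
  rewrite (_ : 1 + 3 * m%:R^-1 = m%:R^-1 + (1 + 2 * m%:R^-1)); last by ring.
  by apply: sqnD_le => //; lra.
exists x'; first by rewrite mem_cat mem_filter x'S x'X orbT.
by apply: le_trans xx' _; rewrite lerXn2r ?nnegrE//; lra.
Qed.

Lemma block_cover n (eps mu : R) (m l : nat) :
  (0 < n)%N -> (4 * n <= m)%N -> 0 < eps < mu -> (0 < l)%N ->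
  exists2 C : seq 'rV[R]_n,
    (size C)%:R <= l.+1%:R * (40 * m%:R ^+ 2 * n%:R ^+ 2 * (mu / eps) ^+ n) &
    forall x, sqn x <= mu ^+ 2 -> exists2 c, c \in C &
      sqn (x - c) <= (eps * (1 + 3 * m%:R^-1)) ^+ 2 * (sqn x / mu ^+ 2 + l%:R^-1).
Proof.
move=> n0 nm /andP[e0 em] l0.
have mu0 : 0 < mu by lra.
have l0' : 0 < l%:R :> R by rewrite ltr0n.
have [|C0 sC0 hC0] := @ball_cover n (mu / eps) m n0 nm.
  by rewrite ltr_pdivlMr// mul1r.
(* Upper ends of the quantization levels of [(|x| / mu) ^ 2]. The cover rescaled by [r i * eps]
   handles radius [r i * mu]. Level [i = l] occurs when [|x| = mu], whence [l.+1] levels. *)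
pose r (i : nat) : R := Num.sqrt (i.+1%:R / l%:R).
have r0 i : 0 < r i by rewrite sqrtr_gt0 divr_gt0// ltr0n.
exists [seq (r i * eps) *: c | i <- iota 0 l.+1, c <- C0].
  by rewrite size_allpairs size_iota natrM ler_pM2l// ltr0n.
move=> x xm; pose i := Num.truncn (l%:R * (sqn x / mu ^+ 2)).
have s0 : 0 <= sqn x / mu ^+ 2 by rewrite divr_ge0 ?sqn_ge0 ?sqr_ge0.
have s1 : sqn x / mu ^+ 2 <= 1 by rewrite ler_pdivrMr ?exprn_gt0// mul1r.
have ri2 : r i ^+ 2 = i.+1%:R / l%:R by rewrite sqr_sqrtr// ltW// divr_gt0// ltr0n.
have re0 : 0 < r i * eps by exact: mulr_gt0.
have /andP[ti1 ti2] := @truncn_itv _ (l%:R * (sqn x / mu ^+ 2)) (mulr_ge0 (ltW l0') s0).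
have [|c cC hc] := hC0 ((r i * eps)^-1 *: x).
  rewrite sqnZ exprVn ler_pdivrMl ?exprn_gt0// exprMn ri2 expr_div_n.
  rewrite -mulrA [eps ^+ 2 * _]mulrC divfK ?gt_eqF ?exprn_gt0//.
  rewrite -ler_pdivrMr ?exprn_gt0// ler_pdivlMr// mulrC; exact: ltW.
exists ((r i * eps) *: c).
  apply/allpairsP; exists (i, c); split=> //.
  rewrite [_.1]/= mem_iota add0n ltnS leq0n /= -(ler_nat R).
  by apply: le_trans ti1 _; rewrite ler_piMr// ltW.
rewrite (_ : x - _ = (r i * eps) *: ((r i * eps)^-1 *: x - c)); last first.
  by rewrite scalerBr scalerA divff ?gt_eqF// scale1r.
rewrite sqnZ; apply: (@le_trans _ _ ((r i * eps) ^+ 2 * (1 + 3 * m%:R^-1) ^+ 2)).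
  by rewrite ler_wpM2l ?sqr_ge0.
rewrite (_ : (r i * eps) ^+ 2 * _ = (eps * (1 + 3 * m%:R^-1)) ^+ 2 * r i ^+ 2);
  last by ring.
rewrite ri2 ler_wpM2l ?sqr_ge0//.
by rewrite -natr1 mulrDl mul1r lerD2r ler_pdivrMr// mulrC.
Qed.

End BallCover.

(** * Covering the ellipsoid *)

Section Blocks.
Context {R : realType}.
Implicit Types (d : nat -> nat) (x c : nat -> R).

Lemma dbarS d k : dbar d k.+1 = (dbar d k + d k)%N.
Proof. exact: big_ord_recr. Qed.

Lemma leq_dbar d j k : (j <= k)%N -> (dbar d j <= dbar d k)%N.
Proof.
move=> /subnK <-; elim: (k - j)%N => // i IH.
by rewrite addSn dbarS; apply: leq_trans IH (leq_addr _ _).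
Qed.

Lemma sum_sqr_blocks d x k :
  \sum_(i < dbar d k) x i ^+ 2 = \sum_(j < k) sqn (block d x j).
Proof.
elim: k => [|k IH]; first by rewrite /dbar !big_ord0.
rewrite dbarS big_split_ord big_ord_recr /= IH; congr (_ + _).
by apply: eq_bigr => i _; rewrite mxE.
Qed.

Lemma eucl_norm_sqr n (v : 'rV[R]_n) : eucl_norm v ^+ 2 = sqn v.
Proof. by rewrite sqr_sqrtr// sqn_ge0. Qed.

(** Centres of the single blocks are concatenated: the counts multiply and the squared errors
    add. *)
Lemma prefix_cover d (mu : nat -> R) (eps : R) (m l k : nat) :
  (forall j, (0 < d j)%N) ->
  (forall j, (j < k)%N -> (4 * d j <= m)%N /\ 0 < eps < mu j) -> (0 < l)%N ->
  exists2 S : seq (nat -> R),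
    (size S)%:R <= \prod_(j < k)
      (l.+1%:R * (40 * m%:R ^+ 2 * (d j)%:R ^+ 2 * (mu j / eps) ^+ d j)) &
    forall x, (forall j, (j < k)%N -> sqn (block d x j) <= mu j ^+ 2) ->
      exists c, [/\ c \in S, forall i, (dbar d k <= i)%N -> c i = 0 &
        \sum_(j < k) sqn (block d (x \- c) j) <= (eps * (1 + 3 * m%:R^-1)) ^+ 2 *
           \sum_(j < k) (sqn (block d x j) / mu j ^+ 2 + l%:R^-1)].
Proof.
move=> d0 + l0; elim: k => [|k IH] hk.
  exists [:: fun=> 0]; first by rewrite big_ord0.
  move=> x _; exists (fun=> 0); split=> //; first by rewrite inE.
  by rewrite !big_ord0 mulr0.
have [|S sS hS] := IH; first by move=> j jk; apply: hk; exact: ltnW.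
have [dm emu] := hk k (ltnSn k).
have [C sC hC] := block_cover (d0 k) dm emu l0.
(* The default 0 makes the glued sequence vanish beyond block [k]. *)
pose glue c (y : 'rV[R]_(d k)) i :=
  if (i < dbar d k)%N then c i else oapp (y ord0) 0 (insub (i - dbar d k)%N).
exists [seq glue c y | c <- S, y <- C].
  rewrite size_allpairs natrM big_ord_recr /=; apply: ler_pM => //.
move=> x hx; have [|c [cS c0 hc]] := hS x.
  by move=> j jk; apply: hx; exact: ltnW.
have [y yC hy] := hC _ (hx k (ltnSn k)).
exists (glue c y); split.
- by apply/allpairsP; exists (c, y).
- move=> i; rewrite dbarS => ki; rewrite /glue ltnNge (leq_trans _ ki) ?leq_addr//=.
  by rewrite insubF// ltn_subLR ?(leq_trans _ ki) ?leq_addr// ltnNge ki.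
rewrite !big_ord_recr /= mulrDr; apply: lerD.
  rewrite (eq_bigr (fun j : 'I_k => sqn (block d (x \- c) j)))// => j _.
  congr sqn; apply/rowP => i; rewrite !mxE /glue /=.
  have -> // : (dbar d j + i < dbar d k)%N.
  apply: leq_trans (leq_dbar d (ltn_ord j)).
  by rewrite dbarS -addnS leq_add2l.
apply: le_trans hy; rewrite le_eqVlt; apply/orP; left; apply/eqP; congr sqn.
apply/rowP => i; rewrite !mxE /glue /= ltnNge leq_addr /= addKn.
rewrite (insubT (fun j => j < d k)%N (ltn_ord i)) /=.
by congr (_ - y _ _); exact: val_inj.
Qed.

Lemma l2norm_leP x (r : R) : 0 <= r ->
  (l2norm x <= r%:E)%E <-> forall n, \sum_(i < n) x i ^+ 2 <= r ^+ 2.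
Proof.
move=> r0; rewrite /l2norm Lnorm_counting//.
under eq_eseriesr do rewrite /= powR_mulrn// real_normK ?num_real//.
set S := (\sum_(0 <= i <oo) _)%E.
have S0 : (0 <= S)%E by apply: nneseries_ge0 => i _ _; rewrite lee_fin sqr_ge0.
have -> : (S `^ 2^-1 <= r%:E)%E = (S <= (r ^+ 2)%:E)%E.
  rewrite poweR12_sqrt// -(lee_sqrt _ (y := (r ^+ 2)%:E)) ?lee_fin ?sqr_ge0//.
  by rewrite /= sqrtr_sqr ger0_norm.
split=> [h n|h].
  rewrite -lee_fin; apply: le_trans h; rewrite -sumEFin.
  rewrite -(big_mkord predT (fun i => (x i ^+ 2)%:E)).
  by apply: nneseries_lim_ge => i _; rewrite lee_fin sqr_ge0.
apply: lime_le; first by apply: is_cvg_nneseries => i _ _; rewrite lee_fin sqr_ge0.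
by apply: nearW => n; rewrite sumEFin lee_fin big_mkord.
Qed.

End Blocks.

Section Covering.
Context {R : realType}.
Implicit Types (d : nat -> nat) (mu : nat -> R).

Lemma covering_number_ge0 (rho : R) K : (0 <= covering_number rho K)%E.
Proof. by apply: le_ereal_inf_tmp => _ [n _ <-]; rewrite lee_fin. Qed.

Lemma covering_number_le (rho : R) K (S : seq (nat -> R)) :
  is_cover rho K [set` S] -> (covering_number rho K <= (size S)%:R%:E)%E.
Proof.
move=> cS; have [n Sn] : exists n, ([set` S] #= `I_n)%card by exact: finite_seq.
apply: ge_ereal_inf; exists n%:R%:E; first by exists n => //; exists [set` S].
rewrite lee_fin ler_nat -(card_fset_set Sn).
apply: uniq_leq_size; first exact: finmap.fset_uniq.
by move=> c; rewrite in_fset_set ?inE//; exact: finite_seq.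
Qed.

Lemma ellipsoid_covering d mu (eps rho : R) (m l k : nat) :
  (forall j, (0 < d j)%N) -> (forall j, 0 < mu j) -> nonincreasing_seq mu ->
  mu k <= eps -> (0 < l)%N -> 0 <= rho ->
  (forall j, (j < k)%N -> (4 * d j <= m)%N /\ 0 < eps < mu j) ->
  (eps * (1 + 3 * m%:R^-1)) ^+ 2 * (1 + k%:R * l%:R^-1) <= rho ^+ 2 ->
  (covering_number rho (mixed_ellipsoid d mu) <= (\prod_(j < k)
      (l.+1%:R * (40 * m%:R ^+ 2 * (d j)%:R ^+ 2 * (mu j / eps) ^+ d j)))%:E)%E.
Proof.
move=> d0 mu0 mu_dec mueps l0 rho0 hk hrho.
have [S sS hS] := prefix_cover d0 hk l0.
(* A cover must lie in [ell2], but [prefix_cover] gives finite support only for the centres it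
   selects; the others are discarded. *)
pose S' := [seq c <- S | `[< forall i, (dbar d k <= i)%N -> c i = 0 >]].
apply: (@le_trans _ _ (size S')%:R%:E); last first.
  by rewrite lee_fin; apply: le_trans sS; rewrite ler_nat size_filter count_size.
apply: covering_number_le; split=> [c|x /l2norm_leP Ex].
  rewrite /= mem_filter => /andP[/asboolP c0 _]; rewrite /ell2 /=.
  apply: le_lt_trans (ltry (Num.sqrt (\sum_(i < dbar d k) c i ^+ 2))).
  apply/l2norm_leP; first exact: sqrtr_ge0.
  move=> n; rewrite sqr_sqrtr; last by apply: sumr_ge0 => i _; exact: sqr_ge0.
  have [nk|/ltnW kn] := leqP n (dbar d k).
    by rewrite -(subnKC nk) big_split_ord lerDl; apply: sumr_ge0 => i _; exact: sqr_ge0.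
  rewrite -(subnKC kn) big_split_ord /= [X in _ + X]big1 ?addr0// => i _.
  by rewrite c0 ?leq_addr// expr0n.
pose a j := sqn (block d x j) / mu j ^+ 2.
have a0 j : 0 <= a j by rewrite divr_ge0 ?sqn_ge0 ?sqr_ge0.
have Ea n : \sum_(j < n) a j <= 1.
  have := Ex ler01 n; rewrite expr1n; apply: le_trans.
  by apply: ler_sum => j _; rewrite expr_div_n eucl_norm_sqr.
have aE j : sqn (block d x j) = a j * mu j ^+ 2.
  by rewrite divfK// gt_eqF// exprn_gt0.
have [|c [cS c0 hc]] := hS x.
  move=> j _; rewrite aE ler_piMl ?sqr_ge0//.
  apply: le_trans (Ea j.+1); rewrite big_ord_recr /= lerDr.
  by apply: sumr_ge0 => i _; exact: a0.
exists c; first by rewrite /= mem_filter cS andbT; exact/asboolP.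
apply/l2norm_leP => // n; apply: le_trans hrho.
(* Extend the partial sum to whole blocks; [n <= dbar d n] because no block is empty. *)
apply: (@le_trans _ _ (\sum_(i < dbar d (k + n)) (x \- c) i ^+ 2)).
  have nd : (n <= dbar d (k + n))%N.
    apply: leq_trans (leq_dbar d (leq_addl k n)).
    elim: (n) => // i IH; rewrite dbarS -addn1; exact: leq_add.
  by rewrite -(subnKC nd) big_split_ord lerDl; apply: sumr_ge0 => i _; exact: sqr_ge0.
rewrite sum_sqr_blocks big_split_ord /=.
have eps0 : 0 <= eps := le_trans (ltW (mu0 k)) mueps.
have im0 : 0 <= 3 * m%:R^-1 :> R by rewrite mulr_ge0// invr_ge0.
have B0 : 0 <= eps * (1 + 3 * m%:R^-1) by rewrite mulr_ge0// addr_ge0.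
have tail : \sum_(j < n) sqn (block d (x \- c) (k + j)) <=
            (eps * (1 + 3 * m%:R^-1)) ^+ 2 * \sum_(j < n) a (k + j)%N.
  rewrite mulr_sumr; apply: ler_sum => j _.
  have -> : block d (x \- c) (k + j) = block d x (k + j).
    apply/rowP => i; rewrite !mxE /= c0 ?subr0//.
    by apply: leq_trans (leq_dbar d (leq_addr _ _)) (leq_addr _ _).
  rewrite aE mulrC ler_wpM2r// lerXn2r ?nnegrE ?(ltW (mu0 _))//.
  apply: le_trans (mu_dec _ _ (leq_addr _ _)) _; apply: le_trans mueps _.
  by rewrite ler_peMr// lerDl.
apply: le_trans (lerD hc tail) _; rewrite -mulrDr ler_wpM2l ?sqr_ge0//.
have := Ea (k + n)%N; rewrite big_split_ord big_split /= sumr_const card_ord.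
by rewrite -[l%:R^-1 *+ k]mulr_natl /a; lra.
Qed.

Lemma prod_powR (k : nat) (a : nat -> R) (e : nat -> R) (r : R) :
  (forall j, 0 <= a j) ->
  (\prod_(j < k) a j `^ e j) `^ r = \prod_(j < k) a j `^ (e j * r).
Proof.
move=> a0; elim: k => [|k IH]; first by rewrite !big_ord0 powR1.
rewrite !big_ord_recr /= powRM ?powR_ge0//; last first.
  by apply: prodr_ge0 => i _; exact: powR_ge0.
by rewrite IH powRrM.
Qed.

(** The tangent bound gives [expR (- 1/2) >= 1/2]; invert and take the fourth power. *)
Lemma expR2_le16 : expR 2 <= 16 :> R.
Proof.
have h : 2^-1 <= expR (- 2^-1) :> R.
  by apply: le_trans (expR_ge1Dx _); lra.
have : expR (- 2^-1) * expR 2^-1 = 1 :> R by rewrite -expRD addNr expR0.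
have h2 := expR_gt0 (2^-1 : R).
move=> e1; have {}h : expR 2^-1 <= 2 :> R by nra.
have -> : expR 2 = expR 2^-1 ^+ 4 :> R by rewrite -expRM_natl; congr expR; lra.
have -> : 16 = 2 ^+ 4 :> R by rewrite -natrX.
by rewrite lerXn2r ?nnegrE// ltW.
Qed.

End Covering.

(** * Choice of parameters and the final estimate *)

Section Rate.
Context {R : realType}.
Implicit Types (d : nat -> nat) (mu : nat -> R).

Lemma covering_number_scale_le d mu (eps gamma : R) (k : nat) :
  (forall j, (0 < d j)%N) -> (forall j, 0 < mu j) -> nonincreasing_seq mu ->
  1 <= gamma -> (0 < k)%N -> mu k <= eps < mu k.-1 ->
  (forall j, (j < k)%N -> (9 <= d j)%N) ->
  (covering_number (eps_gamma d k eps gamma) (mixed_ellipsoid d mu) <=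
     (((dbar d k)%:R `^ gamma) ^+ (16 * k) *
      \prod_(j < k) (mu j / eps) ^+ d j)%:E)%E.
Proof.
move=> d0 mu0 mu_dec g1 k0 /andP[mueps epsmu] d9.
have eps0 : 0 < eps by exact: lt_le_trans (mu0 k) mueps.
have k9 : (9 * k <= dbar d k)%N.
  rewrite mulnC -[X in (X * _)%N]card_ord -sum_nat_const.
  by apply: leq_sum => j _; exact: d9.
have D1 : 1 <= (dbar d k)%:R :> R by rewrite ler1n; lia.
set w := _ `^ gamma.
have Dw : (dbar d k)%:R <= w by exact: le1r_powR.
have w9 : 9 <= w.
  by apply: le_trans Dw; rewrite ler_nat; lia.
have wk : k%:R <= w by apply: le_trans Dw; rewrite ler_nat; lia.
have dw j : (j < k)%N -> (d j)%:R <= w.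
  move=> jk; apply: le_trans Dw; rewrite ler_nat.
  by rewrite /dbar (bigD1 (Ordinal jk)) //= leq_addr.
(* Makes [3 / m] at most [w^-1 / 4]; with [l = m * m] levels the quantization error [k / l] is at
   most [w^-1]. *)
pose m := (Num.truncn (12 * w)).+1.
have m12 : 12 * w <= m%:R by rewrite ltW// truncnS_gt.
have m13 : m%:R <= 13 * w.
  rewrite /m -(natr1 (Num.truncn (12 * w)));
  have : (Num.truncn (12 * w))%:R <= 12 * w by rewrite truncn_le; lra.
  by lra.
have m0 : 0 < m%:R :> R by lra.
have im : m%:R * m%:R^-1 = 1 :> R by rewrite divff// gt_eqF.
have im0 : 0 < m%:R^-1 :> R by rewrite invr_gt0.
have iw : w * w^-1 = 1 by rewrite divff// gt_eqF//; lra.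
have iw0 : 0 < w^-1 by rewrite invr_gt0; lra.
have rhoE : eps_gamma d k eps gamma = eps * (1 + w^-1 * Num.sqrt k.+1%:R).
  by rewrite /eps_gamma powRN.
have s1 : 1 <= Num.sqrt k.+1%:R :> R by rewrite -[leLHS]sqrtr1 ler_sqrt ?ler1n.
have ws : w^-1 <= w^-1 * Num.sqrt k.+1%:R by rewrite ler_peMr// ltW.
have im4 : 3 * m%:R^-1 <= w^-1 / 4.
  by rewrite ler_pdivrMr//; nra.
have kl : k%:R * (m * m)%:R^-1 <= w^-1.
  rewrite ler_pdivrMr ?ltr0n// natrM.
  have : w * (w^-1 * (m%:R * m%:R)) = m%:R * m%:R by rewrite [LHS]mulrA iw mul1r.
  by nra.
rewrite rhoE.
apply: le_trans (ellipsoid_covering (m := m) (l := m * m) d0 mu0 mu_dec mueps _ _ _ _) _.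
- by rewrite muln_gt0.
- by rewrite mulr_ge0 ?ltW//; lra.
- move=> j jk; split.
    by rewrite -(ler_nat R) natrM; have := dw j jk; lra.
  rewrite eps0 /=; apply: lt_le_trans epsmu _; apply: mu_dec.
  by case: (k) jk.
- rewrite !exprMn -mulrA ler_wpM2l ?sqr_ge0//.
  have iw1 : w^-1 <= 1 by rewrite invf_le1; lra.
  (* The factor [Num.sqrt k.+1%:R >= 1] allows this radius, and [(1 + w^-1 / 4) ^+ 2 <= 1 + w^-1]
     leaves one factor for the quantization. *)
  apply: (@le_trans _ _ ((1 + w^-1) ^+ 2)); last first.
    by rewrite lerXn2r ?nnegrE//; lra.
  apply: (@le_trans _ _ ((1 + w^-1 / 4) ^+ 2 * (1 + w^-1))); last by nra.
  have kl0 : 0 <= k%:R * (m * m)%:R^-1 :> R by rewrite mulr_ge0// invr_ge0.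
  apply: ler_pM.
  + exact: sqr_ge0.
  + by lra.
  + by rewrite lerXn2r ?nnegrE//; lra.
  + by lra.
(* Per block the polynomial factor is at most [80 * (13 * w) ^+ 4 * w ^+ 2], and [w >= 9] gives
   [80 <= w ^+ 2] and [(13 * w) ^+ 2 <= w ^+ 6]. *)
have -> : w ^+ (16 * k) = \prod_(j < k) w ^+ 16.
  by rewrite prodr_const card_ord exprM.
rewrite lee_fin -big_split /=; apply: ler_prod => j _.
have t0 : 0 <= (mu j / eps) ^+ d j by rewrite exprn_ge0// divr_ge0// ltW.
rewrite !mulr_ge0// ?sqr_ge0//= mulrA ler_wpM2r//.
have h1 : (m * m).+1%:R <= 2 * (13 * w) ^+ 2 :> R.
  rewrite -(natr1 (m * m)%N) natrM; nra.
have h2 : m%:R ^+ 2 <= (13 * w) ^+ 2 :> R by rewrite lerXn2r ?nnegrE//; lra.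
have h3 : (d j)%:R ^+ 2 <= w ^+ 2 :> R by rewrite lerXn2r ?nnegrE ?dw//; lra.
apply: (@le_trans _ _ (2 * (13 * w) ^+ 2 * (40 * (13 * w) ^+ 2 * w ^+ 2))).
  apply: ler_pM; rewrite ?mulr_ge0 ?sqr_ge0//.
  by apply: ler_pM; rewrite ?mulr_ge0 ?sqr_ge0// ler_wpM2l.
have w80 : 80 <= w ^+ 2 by nra.
have h13 : (13 * w) ^+ 2 <= w ^+ 6.
  have w3 : 13 * w <= w ^+ 3 by rewrite exprS; nra.
  have w13 : 0 <= 13 * w by lra.
  by rewrite (exprM w 3 2) lerXn2r ?nnegrE ?(le_trans w13).
rewrite (_ : _ * _ = 80 * (13 * w) ^+ 2 * (13 * w) ^+ 2 * w ^+ 2); last by ring.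
rewrite (_ : w ^+ 16 = w ^+ 2 * w ^+ 6 * w ^+ 6 * w ^+ 2); last by ring.
have h0 : 0 <= (13 * w) ^+ 2 by exact: sqr_ge0.
rewrite ler_wpM2r ?sqr_ge0//; apply: ler_pM => //; first exact: mulr_ge0.
by apply: ler_pM.
Qed.

(** By [1 + y <= expR y], with [dbar d k <= w] and [Num.sqrt k.+1%:R <= 2 * k], the enlargement
    contributes at most [expR (2 * k)], and [expR 2 <= 16 <= w ^+ 2]. *)
Lemma eps_gamma_pow_le d (eps gamma : R) (k : nat) :
  0 < eps -> 1 <= gamma -> (0 < k)%N -> (9 <= dbar d k)%N ->
  eps_gamma d k eps gamma ^+ dbar d k <=
    eps ^+ dbar d k * ((dbar d k)%:R `^ gamma) ^+ (2 * k).
Proof.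
move=> eps0 g1 k0 D9.
have D1 : 1 <= (dbar d k)%:R :> R by rewrite ler1n; lia.
rewrite /eps_gamma powRN; set w := _ `^ gamma.
have Dw : (dbar d k)%:R <= w by exact: le1r_powR.
have w9 : 9 <= w by apply: le_trans Dw; rewrite ler_nat.
have w0 : 0 < w by lra.
rewrite exprMn ler_wpM2l ?exprn_ge0 ?(ltW eps0)//.
set s := Num.sqrt _.
have s0 : 0 <= s by exact: sqrtr_ge0.
have sk : s <= 2 * k%:R.
  have k1 : 1 <= k%:R :> R by rewrite ler1n.
  rewrite -(@ler_pXn2r _ 2)// ?nnegrE ?mulr_ge0// sqr_sqrtr// -(natr1 k); nra.
apply: (@le_trans _ _ (expR ((dbar d k)%:R * (w^-1 * s)))).
  rewrite expRM_natl lerXn2r ?nnegrE ?expR_ge0//; last exact: expR_ge1Dx.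
  by rewrite addr_ge0// mulr_ge0// invr_ge0 ltW.
apply: (@le_trans _ _ (expR (k%:R * 2))).
  rewrite ler_expR mulrA mulrC [leRHS]mulrC.
  rewrite -[leRHS]mulr1; apply: ler_pM => //.
    by rewrite divr_ge0// ltW.
  by rewrite ler_pdivrMr// mul1r.
rewrite expRM_natl exprM lerXn2r ?nnegrE ?exprn_ge0 ?expR_ge0 ?(ltW w0)//.
by apply: le_trans expR2_le16 _; nra.
Qed.

End Rate.

Theorem theorem12 (R : realType) (d : nat -> nat) (mu : nat -> R)
  (d_gt0 : forall n, (0 < d n)%N)
  (mu_gt0 : forall n, 0 < mu n)
  (mu_noninc : nonincreasing_seq mu)
  (mu_cvg0 : mu @ \oo --> (0 : R)) :
  exists kappa : nat -> R -> R,
    [/\ forall k gamma, 0 < kappa k gamma,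
        forall gamma : nat -> R, (forall k, 1 <= gamma k) ->
          (fun k => log2 (kappa k (gamma k))) =O_\oo
          (fun k => gamma k * k%:R * log2 (dbar d k)%:R / (dbar d k)%:R)
      & forall (eps gamma : R) (k : nat),
          0 < eps < mu 0%N -> 1 <= gamma -> (0 < k)%N ->
          mu k <= eps < mu k.-1 ->
          (forall j, (j < k)%N -> (9 <= d j)%N) ->
          (covering_number (eps_gamma d k eps gamma) (mixed_ellipsoid d mu)
             `^ ((dbar d k)%:R)^-1 * (eps_gamma d k eps gamma)%:E
           <= (kappa k gamma
               * \prod_(j < k) mu j `^ ((d j)%:R / (dbar d k)%:R))%:E)%E].
Proof.
have ln2 : 0 < ln 2 :> R by apply: ln_gt0; lra.
pose f gamma k : R := gamma * k%:R * log2 (dbar d k)%:R / (dbar d k)%:R.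
(* 18 is 16 from the covering number plus 2 from the enlarged radius; [log2] of this is exactly
   [18 * f gamma k]. *)
exists (fun k gamma => 2 `^ (18 * f gamma k)); split.
- by move=> k gamma; apply: powR_gt0.
- move=> gamma _; apply/eqOP; near=> C; apply: nearW => k.
  rewrite /log2 ln_powR mulfK ?gt_eqF// normrM ler_wpM2r//.
move=> eps gamma k /andP[eps0 _] g1 k0 emu d9.
have D9 : (9 <= dbar d k)%N.
  by rewrite /dbar (bigD1 (Ordinal k0))//= (leq_trans (d9 _ k0)) ?leq_addr.
have D0 : 0 < (dbar d k)%:R :> R by rewrite ltr0n; lia.
have iD0 : 0 < (dbar d k)%:R^-1 :> R by rewrite invr_gt0.
have hN := covering_number_scale_le d_gt0 mu_gt0 mu_noninc g1 k0 emu d9.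
have he := eps_gamma_pow_le eps0 g1 k0 D9.
set w := _ `^ gamma in hN he *.
set T := _ * _ in hN.
have e0 : 0 < eps_gamma d k eps gamma.
  by rewrite mulr_gt0// ltr_wpDr// mulr_ge0 ?powR_ge0 ?sqrtr_ge0.
have w0 : 0 < w by exact: powR_gt0.
have T0 : 0 <= T.
  rewrite mulr_ge0 ?exprn_ge0 ?(ltW w0)//; apply: prodr_ge0 => j _.
  by rewrite exprn_ge0// divr_ge0// ltW.
apply: (@le_trans _ _ (T%:E `^ (dbar d k)%:R^-1 * (eps_gamma d k eps gamma)%:E)%E).
  rewrite lee_wpmul2r ?lee_fin ?(ltW e0)//.
  apply: gt0_ler_poweR => //.
    by rewrite in_itv /= covering_number_ge0 leey.
  by rewrite in_itv /= lee_fin T0 leey.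
rewrite poweR_EFin -EFinM lee_fin.
(* Every factor is put under one root of order [dbar d k], so that only the bases need comparing. *)
have eE : eps_gamma d k eps gamma =
          (eps_gamma d k eps gamma ^+ dbar d k) `^ (dbar d k)%:R^-1.
  by rewrite -powR_mulrn ?(ltW e0)// -powRrM divff ?gt_eqF// powRr1// ltW.
rewrite eE -powRM ?exprn_ge0 ?(ltW e0)//.
have -> : 2 `^ (18 * f gamma k) = (w ^+ (18 * k)) `^ (dbar d k)%:R^-1.
  rewrite -powR_mulrn ?(ltW w0)// /w -!powRrM /powR !gt_eqF//; congr expR.
  by rewrite /f /log2 natrM; field; rewrite !gt_eqF.
have := prod_powR k (fun j => (d j)%:R) (dbar d k)%:R^-1 (fun j => ltW (mu_gt0 j)).
move=> <-; rewrite -powRM ?exprn_ge0 ?(ltW w0)//; last first.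
  by apply: prodr_ge0 => j _; exact: powR_ge0.
have Q0 : 0 <= \prod_(j < k) mu j `^ (d j)%:R.
  by apply: prodr_ge0 => j _; exact: powR_ge0.
apply: ge0_ler_powR.
- exact: ltW.
- by rewrite nnegrE mulr_ge0// exprn_ge0// ltW.
- by rewrite nnegrE mulr_ge0// exprn_ge0// ltW.
(* What remains is an equality: the powers of [eps] cancel. *)
apply: le_trans (ler_wpM2l T0 he) _; rewrite le_eqVlt; apply/orP; left; apply/eqP.
rewrite /T /dbar -prodrXr.
rewrite (eq_bigr (fun j : 'I_k => mu j ^+ d j / eps ^+ d j)); last first.
  by move=> j _; rewrite expr_div_n.
rewrite [in RHS](eq_bigr (fun j : 'I_k => mu j ^+ d j)); last first.
  by move=> j _; rewrite powR_mulrn// ltW.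
rewrite prodf_div (_ : 18 * k = 16 * k + 2 * k)%N; last by rewrite -mulnDl.
have E0 : \prod_(j < k) eps ^+ d j != 0.
  by apply/prodf_neq0 => j _; rewrite expf_neq0// gt_eqF.
rewrite exprD; move: (w ^+ (16 * k)) (w ^+ (2 * k)) => a b.
by move: (\prod_(j < k) eps ^+ d j) E0 => E E0; field.
Unshelve. all: by end_near. Qed.
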